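(* Let $I=\langle T_0^{d_1},T_0^{u_1}T_1^{u_2},T_1^{d_2}\rangle\subset\mathbb{K}[T_0,T_1]$ with $0<u_1<d_1$, $0<u_2<d_2$, and let $G(\mathcal{R}(I))$ be the minimal generating set of its Rees ideal $\mathcal{R}(I)\subset\mathbb{K}[T_0,T_1,X_0,X_1,X_2]$, normalized with respect to the term order $\prec$ defined in the context. Let $g_0:=T_1^{d_2}X_0-T_0^{d_1}X_2$. Then $\overline{G}(\mathcal{R}(I)):=\{g_0\}\cup G(\mathcal{R}(I))$ is the minimal Gröbner basis of $\mathcal{R}(I)$ with respect to $\prec$.
   Context: $\mathbb{K}$ is a field, $S=\mathbb{K}[T_0,T_1,X_0,X_1,X_2]$. The Rees ideal $\mathcal{R}(I)$ is the kernel of the $\mathbb{K}[T_0,T_1]$-algebra map $\phi:S\to\mathbb{K}[T_0,T_1][z]$, $X_0\mapsto T_0^{d_1}z$, $X_1\mapsto T_0^{u_1}T_1^{u_2}z$, $X_2\mapsto T_1^{d_2}z$. Term order $\prec$: for $\sigma=T_0^{a_0}T_1^{a_1}X_0^{b_0}X_1^{b_1}X_2^{b_2}$ and $\tau=T_0^{c_0}T_1^{c_1}X_0^{e_0}X_1^{e_1}X_2^{e_2}$, $\sigma\prec\tau$ iff $X_0^{b_0}X_1^{b_1}X_2^{b_2}\prec_{\rm drl}X_0^{e_0}X_1^{e_1}X_2^{e_2}$, or these $X$-monomials are equal and $T_0^{a_0}T_1^{a_1}\prec_{\rm drl}T_0^{c_0}T_1^{c_1}$; here $\prec_{\rm drl}$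 is the degree reverse lexicographic order with $X_2\prec_{\rm drl} X_0\prec_{\rm drl} X_1$ and $T_0\prec_{\rm drl} T_1$. Minimal generating set $G(\mathcal{R}(I))$. It consists of binomials with coefficients $\pm1$ and is unique up to signs; normalized means leading coefficients are $1$. Explicitly it is obtained as follows. For $k\in\{1,2\}$, $j\ge1$ let $a^{(k)}_j=u_kj\bmod d_k\in\{0,\dots,d_k-1\}$, $b^{(k)}_j=\lfloor u_kj/d_k\rfloor$. Start with $g_1=T_0^{d_1-u_1}X_1-T_1^{u_2}X_0$, $g_2=T_1^{d_2-u_2}X_1-T_0^{u_1}X_2$ and $\max^{(k)}=\min^{(k)}=u_k$. For $j=2,3,\dots$: (i) if $b^{(1)}_j-b^{(1)}_{j-1}=b^{(2)}_j-b^{(2)}_{j-1}=0$, append $T_0^{d_1-a^{(1)}_j}T_1^{d_2-a^{(2)}_j}X_1^j-X_0^{b^{(1)}_j+1}X_2^{b^{(2)}_j+1}$ and stop; (ii) if both differences equal $1$, append $X_1^j-T_0^{a^{(1)}_j}T_1^{a^{(2)}_j}X_0^{b^{(1)}_j}X_2^{b^{(2)}_j}$ and stop; (iii) otherwise, if $a^{(1)}_j>\max^{(1)}$ and $a^{(2)}_j<\min^{(2)}$, append $T_0^{d_1-a^{(1)}_j}X_1^j-T_1^{a^{(2)}_j}X_0^{b^{(1)}_j+1}X_2^{b^{(2)}_j}$ and set $\max^{(1)}=a^{(1)}_j$, $\min^{(2)}=a^{(2)}_j$; if $a^{(1)}_j<\min^{(1)}$ and $a^{(2)}_j>\max^{(2)}$,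 append $T_1^{d_2-a^{(2)}_j}X_1^j-T_0^{a^{(1)}_j}X_0^{b^{(1)}_j}X_2^{b^{(2)}_j+1}$ and set $\min^{(1)}=a^{(1)}_j$, $\max^{(2)}=a^{(2)}_j$; then stop if $a^{(1)}_j=0$ or $a^{(2)}_j=0$. *)

(* Defs.v *)
From mathcomp Require Import all_boot all_order all_algebra.
From mathcomp.multinomials Require Import mpoly.

Set Implicit Arguments.
Unset Strict Implicit.
Unset Printing Implicit Defensive.

Import GRing.Theory.
Local Open Scope ring_scope.

Section Ideals.
Variables (K : fieldType) (n : nat).
Implicit Types (A I : {mpoly K[n]} -> Prop) (G H : seq {mpoly K[n]}).
Implicit Types (p q : {mpoly K[n]}) (m : 'X_{1..n}).

Definition ideal_gen A p : Prop :=
  exists2 s : seq ({mpoly K[n]} * {mpoly K[n]}),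
    (forall x, x \in s -> A x.2) & p = \sum_(x <- s) x.1 * x.2.

Definition generates I G : Prop :=
  forall p, I p <-> ideal_gen (fun g => g \in G) p.

Definition pm1_binomial p : bool :=
  (size (msupp p) == 2%N)
  && all (fun m => (p@_m == 1) || (p@_m == -1)) (msupp p).

Variable lt : rel 'X_{1..n}.

Definition lead_monomial p m : Prop :=
  m \in msupp p /\ forall m', m' \in msupp p -> m' != m -> lt m' m.

Definition normalized p : Prop :=
  exists2 m, lead_monomial p m & p@_m = 1.

(* The finite set of generators is represented by a duplicate-free list, so
   lists are to be compared with [perm_eq]. *)
Definition min_binomial_gens I G : Prop :=
  [/\ uniq G,
      forall g, g \in G -> pm1_binomial g /\ normalized g,
      generates I G
    & forall H, {subset H <= G} -> generates I H -> {subset G <= H}].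

Definition initial_ideal A : {mpoly K[n]} -> Prop :=
  ideal_gen (fun q => exists f m, [/\ A f, lead_monomial f m & q = 'X_[m]]).

Definition groebner_basis I G : Prop :=
  (forall g, g \in G -> I g) /\
  (forall p, initial_ideal I p <-> initial_ideal (fun g => g \in G) p).

Definition minimal_groebner_basis I G : Prop :=
  [/\ uniq G,
      groebner_basis I G,
      forall g, g \in G -> normalized g
    & forall g h mg mh, g \in G -> h \in G -> g != h ->
        lead_monomial g mg -> lead_monomial h mh -> ~~ (mg <= mh)%MM].

End Ideals.

(* The variables T_0, T_1, X_0, X_1, X_2 of S have indices 0, 1, 2, 3, 4. *)
Definition iT0 : 'I_5 := Ordinal (isT : (0 < 5)%N).
Definition iT1 : 'I_5 := Ordinal (isT : (1 < 5)%N).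
Definition iX0 : 'I_5 := Ordinal (isT : (2 < 5)%N).
Definition iX1 : 'I_5 := Ordinal (isT : (3 < 5)%N).
Definition iX2 : 'I_5 := Ordinal (isT : (4 < 5)%N).

Fixpoint lexlt (s t : seq nat) : bool :=
  match s, t with
  | x :: s', y :: t' => (x < y)%N || (x == y) && lexlt s' t'
  | _, _ => false
  end.

(* Exponents are listed from the smallest variable to the largest one. *)
Definition drl (s t : seq nat) : bool :=
  (sumn s < sumn t)%N || (sumn s == sumn t) && lexlt t s.

Definition Texps (m : 'X_{1..5}) : seq nat := [:: m iT0; m iT1].
Definition Xexps (m : 'X_{1..5}) : seq nat := [:: m iX2; m iX0; m iX1].

Definition prec (m m' : 'X_{1..5}) : bool :=
  drl (Xexps m) (Xexps m')
  || (Xexps m == Xexps m') && drl (Texps m) (Texps m').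

Section Rees.
Variables (K : fieldType) (d1 d2 u1 u2 : nat).

Let T0 : {mpoly K[5]} := 'X_iT0.
Let T1 : {mpoly K[5]} := 'X_iT1.
Let X0 : {mpoly K[5]} := 'X_iX0.
Let X1 : {mpoly K[5]} := 'X_iX1.
Let X2 : {mpoly K[5]} := 'X_iX2.

(* K[T_0, T_1][z] is {mpoly K[3]}, with variables T_0, T_1, z in this order. *)
Definition rees_map (p : {mpoly K[5]}) : {mpoly K[3]} :=
  let t0 : {mpoly K[3]} := 'X_(Ordinal (isT : (0 < 3)%N)) in
  let t1 : {mpoly K[3]} := 'X_(Ordinal (isT : (1 < 3)%N)) in
  let z : {mpoly K[3]} := 'X_(Ordinal (isT : (2 < 3)%N)) in
  p \mPo [tuple t0; t1; t0 ^+ d1 * z; t0 ^+ u1 * t1 ^+ u2 * z; t1 ^+ d2 * z].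

Definition rees_ideal (p : {mpoly K[5]}) : Prop := rees_map p = 0.

Definition rees_g0 : {mpoly K[5]} := T1 ^+ d2 * X0 - T0 ^+ d1 * X2.

(* The recursion producing the generators in X_1-degree at least j. The state
   variables are max^(1), min^(1), max^(2), min^(2). *)
Fixpoint rees_loop (fuel j M1 m1 M2 m2 : nat) : seq {mpoly K[5]} :=
  if fuel is fuel'.+1 then
    let a1 := ((u1 * j) %% d1)%N in
    let a2 := ((u2 * j) %% d2)%N in
    let b1 := ((u1 * j) %/ d1)%N in
    let b2 := ((u2 * j) %/ d2)%N in
    let c1 := (b1 - (u1 * j.-1) %/ d1)%N in
    let c2 := (b2 - (u2 * j.-1) %/ d2)%N in
    if (c1 == 0%N) && (c2 == 0%N) then
      [:: T0 ^+ (d1 - a1) * T1 ^+ (d2 - a2) * X1 ^+ j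
          - X0 ^+ b1.+1 * X2 ^+ b2.+1]
    else if (c1 == 1%N) && (c2 == 1%N) then
      [:: X1 ^+ j - T0 ^+ a1 * T1 ^+ a2 * X0 ^+ b1 * X2 ^+ b2]
    else
      let next := if (a1 == 0%N) || (a2 == 0%N) then fun _ _ _ _ => [::]
                  else rees_loop fuel' j.+1 in
      if (M1 < a1)%N && (a2 < m2)%N then
        T0 ^+ (d1 - a1) * X1 ^+ j - T1 ^+ a2 * X0 ^+ b1.+1 * X2 ^+ b2
          :: next a1 m1 M2 a2
      else if (a1 < m1)%N && (M2 < a2)%N then
        T1 ^+ (d2 - a2) * X1 ^+ j - T0 ^+ a1 * X0 ^+ b1 * X2 ^+ b2.+1
          :: next M1 a1 a2 m2
      else next M1 m1 M2 m2
  else [::].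

(* Since u1 * d1 = 0 mod d1, the recursion stops at some j <= d1, so that the
   fuel d1 is never exhausted when 0 < u1 < d1. *)
Definition rees_gens : seq {mpoly K[5]} :=
  [:: T0 ^+ (d1 - u1) * X1 - T1 ^+ u2 * X0,
      T1 ^+ (d2 - u2) * X1 - T0 ^+ u1 * X2
    & rees_loop d1 2 u1 u1 u2 u2].

End Rees.

(* Main.v *)
Require Import Defs.
From mathcomp Require Import all_boot all_order all_algebra.
From mathcomp Require Import zify ring.
From mathcomp.multinomials Require Import mpoly.

(** For integers j and b put x = d1 b - u1 j and y = d2 (j - b) - u2 j.  The
binomial T_0^x T_1^y X_1^j - X_0^b X_2^(j-b), with negative exponents moved to
the other side, lies in the Rees ideal, and the exponent vectors of all
binomials of the ideal form the lattice of rank two obtained in this way.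

If two distinct monomials have the same image, that is, lie in the same fiber,
then the larger one is divisible by T_1^d2 X_0, the leading monomial of g_0, or
by the leading monomial T_0^(x+) T_1^(y+) X_1^j of some vector with j > 0 and
0 <= b <= j ([fiber_div]).  As every element of the ideal has, next to each of its
monomials, another one in the same fiber, g_0 and the binomials of some vectors
form a Groebner basis as soon as the leading monomial of every other vector is
divisible by that of one of them.

The recursion finds these vectors as the Stern-Brocot process does.  Its state
is a basis A, B of the lattice with coordinates (x, y) of signs (+, -) and
(-, +).  Every vector on a level j smaller than jA + jB lies beyond A or beyond
B, so nothing happens there ([frame_interior]); on the level jA + jB the mediant
A + B appears, and the signs of its coordinates decide which case of the
recursion applies ([rees_loop_frame]).  The mediant is isolated: no other leading
monomial divides its leading monomial ([isolated_mediant]).  Conversely the positive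
combinations of A and B are cut by A + B into two cones, in which a leading
monomial is divisible by one already found or which the recursion handles later
(the lemmas on [dominated]).

Isolation means that the fiber of the leading monomial of such a vector consists
of the two terms of its binomial, which are coprime.  Hence the binomial occurs
in every generating set of normalized binomials ([indispensable]), which makes
the minimal generating set unique; and the second term of a binomial is
determined by the first, which makes the Groebner basis unique among those made
of such binomials.  Finally g_0 = T_0^(d1-u1) g_2 - T_1^(d2-u2) g_1 is redundant
as a generator, while no other leading monomial divides T_1^d2 X_0. *)

Set Implicit Arguments.
Unset Strict Implicit.
Unset Printing Implicit Defensive.
Import Order.TTheory GRing.Theory Num.Theory.
Local Open Scope ring_scope.

(** * Ideals generated by a set of polynomials *)

Section IdealGen.
Variables (K : fieldType) (n : nat).
Implicit Types (A B : {mpoly K[n]} -> Prop) (p q : {mpoly K[n]}).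

Lemma ideal_gen_mem A p : A p -> ideal_gen A p.
Proof.
move=> Ap; exists [:: (1, p)]; last by rewrite big_seq1 mul1r.
by move=> x; rewrite inE => /eqP ->.
Qed.

Lemma ideal_gen0 A : ideal_gen A 0.
Proof. by exists [::]; rewrite ?big_nil. Qed.

Lemma ideal_genD A p q : ideal_gen A p -> ideal_gen A q -> ideal_gen A (p + q).
Proof.
move=> [s sA ->] [t tA ->]; exists (s ++ t); last by rewrite big_cat.
by move=> x; rewrite mem_cat => /orP[]; [apply: sA | apply: tA].
Qed.

Lemma ideal_genM A p q : ideal_gen A q -> ideal_gen A (p * q).
Proof.
move=> [s sA ->]; exists [seq (p * x.1, x.2) | x <- s].
  by move=> x /mapP[y ys ->] /=; apply: sA.
by rewrite big_map mulr_sumr; apply: eq_bigr => x _; rewrite mulrA.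
Qed.

Lemma ideal_gen_trans A B p :
  (forall q, A q -> ideal_gen B q) -> ideal_gen A p -> ideal_gen B p.
Proof.
move=> AB [s sA ->]; elim: s sA => [|x s IHs] sA.
  by rewrite big_nil; apply: ideal_gen0.
rewrite big_cons; apply: ideal_genD.
  by apply/ideal_genM/AB/sA; rewrite mem_head.
by apply: IHs => y ys; apply: sA; rewrite inE ys orbT.
Qed.

Lemma ideal_gen_sub A B p :
  (forall q, A q -> B q) -> ideal_gen A p -> ideal_gen B p.
Proof. by move=> AB; apply: ideal_gen_trans => q /AB; apply: ideal_gen_mem. Qed.

(** Cancellation can only remove monomials: one that survives in a combination
    is a multiple of a monomial of one of the generators. *)
Lemma ideal_gen_msupp A p m : ideal_gen A p -> m \in msupp p ->
  exists q m1 m2, [/\ A q, m2 \in msupp q & m = (m1 + m2)%MM].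
Proof.
move=> [s sA ->] /msupp_sum_le /flattenP[ms /mapP[x]].
rewrite filter_predT => xs -> /msuppM_le /allpairsP[[m1 m2] /= [_ m2s ->]].
by exists x.2, m1, m2; split=> //; apply: sA.
Qed.

End IdealGen.

(** * Kernels of linear maps sending monomials to monomials *)

Section ToricIdeal.
Variables (K : fieldType) (n k : nat).
Variables (f : {linear {mpoly K[n]} -> {mpoly K[k]}}).
Variable (phi : 'X_{1..n} -> 'X_{1..k}).
Hypothesis fX : forall m, f 'X_[m] = 'X_[phi m].
Implicit Types (p q g : {mpoly K[n]}) (m : 'X_{1..n}).

Definition mbinom (mm : 'X_{1..n} * 'X_{1..n}) : {mpoly K[n]} :=
  'X_[mm.1] - 'X_[mm.2].

Lemma mem_msupp_mbinom m1 m2 m : m1 != m2 ->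
  (m \in msupp (mbinom (m1, m2))) = (m == m1) || (m == m2).
Proof.
move=> ne; rewrite mcoeff_msupp mcoeffB !mcoeffX.
have [e1|ne1] := eqVneq m1 m.
  have -> : m2 == m = false by rewrite -e1 eq_sym (negPf ne).
  by rewrite subr0 oner_eq0.
rewrite sub0r oppr_eq0 [m == m2]eq_sym.
by case: (m2 == m); rewrite ?oner_eq0 ?eqxx.
Qed.

Lemma pm1_binomial_mbinom m1 m2 : m1 != m2 -> pm1_binomial (mbinom (m1, m2)).
Proof.
move=> ne; rewrite /pm1_binomial.
have /perm_size -> : perm_eq (msupp (mbinom (m1, m2))) [:: m1; m2].
  by apply: uniq_perm => [||m]; rewrite /= ?inE ?ne ?mem_msupp_mbinom.
rewrite eqxx; apply/allP => m; rewrite mem_msupp_mbinom // mcoeffB !mcoeffX.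
case/orP => /eqP ->.
  by rewrite eqxx [m2 == m1]eq_sym (negPf ne) subr0 eqxx.
by rewrite eqxx (negPf ne) sub0r eqxx orbT.
Qed.

Lemma toric_binomial m1 m2 : phi m1 = phi m2 -> f (mbinom (m1, m2)) = 0.
Proof. by move=> e; rewrite raddfB /= !fX e subrr. Qed.

Lemma toric_mcoeff p d :
  (f p)@_d = \sum_(m <- msupp p) p@_m * (phi m == d)%:R.
Proof.
rewrite {1}[p]mpolyE !raddf_sum /=; apply: eq_bigr => m _.
by rewrite linearZ /= fX mcoeffZ mcoeffX.
Qed.

(** The terms of [p] with the same image cancel, hence none of them is alone in
    its fiber. *)
Lemma toric_partner p m : f p = 0 -> m \in msupp p ->
  exists m', [/\ m' \in msupp p, m' != m & phi m' = phi m].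
Proof.
move=> fp0 mp.
have [/hasP[m' m'p /andP[ne /eqP e]]|/hasPn alone] :=
  boolP (has (fun m' => (m' != m) && (phi m' == phi m)) (msupp p)).
  by exists m'.
have := toric_mcoeff p (phi m); rewrite fp0 mcoeff0 (bigD1_seq m) //=.
rewrite eqxx mulr1 big_seq_cond big1 ?addr0 => [/esym/eqP|m' /andP[m'p ne]].
  by rewrite mcoeff_eq0 mp.
by have := alone m' m'p; rewrite ne /= => /negPf ->; rewrite mulr0.
Qed.

(** Subtracting a multiple of the binomial of a monomial of [p] and its partner
    removes that monomial and adds none. *)
Lemma toric_span A p : f p = 0 ->
  (forall m1 m2, phi m1 = phi m2 -> ideal_gen A (mbinom (m1, m2))) ->
  ideal_gen A p.
Proof.
move=> fp0 Abin; have [N] := ubnP (size (msupp p)).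
elim: N p fp0 => // N IHN p fp0 lepN.
have [->|p0] := eqVneq p 0; first exact: ideal_gen0.
move: p0; rewrite -msupp_eq0.
case msp: (msupp p) => [//|m ms] _.
have mp : m \in msupp p by rewrite msp mem_head.
have [m' [m'p ne e]] := toric_partner fp0 mp.
pose q := p - p@_m *: mbinom (m, m').
have -> : p = (p@_m)%:MP * mbinom (m, m') + q by rewrite mul_mpolyC addrC subrK.
apply: ideal_genD; first exact/ideal_genM/Abin.
apply: IHN.
  by rewrite raddfB /= linearZ /= toric_binomial // scaler0 fp0 subr0.
have qle : {subset msupp q <= rem m (msupp p)}.
  move=> a; rewrite /q /mbinom scalerBr opprB addrCA addrC.
  move=> /msuppD_le; rewrite mem_cat (perm_mem (msupp_rem p m)).
  case/orP => // /msuppZ_le; rewrite msuppX inE => /eqP ->.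
  by rewrite mem_rem_uniq // inE ne.
have := uniq_leq_size (msupp_uniq q) qle.
by move: lepN; rewrite size_rem // msp /= => lepN /leq_ltn_trans; apply.
Qed.

(** The sum of the two coefficients vanishes, which fixes the sign of the second
    term in every characteristic. *)
Lemma toric_pm1_binomial p m : f p = 0 -> pm1_binomial p -> p@_m = 1 ->
  exists m', [/\ p = mbinom (m, m'), m' != m, m' \in msupp p & phi m' = phi m].
Proof.
move=> fp0 /andP[/eqP sz _] pm1.
have mp : m \in msupp p by rewrite mcoeff_msupp pm1 oner_eq0.
have [m' [m'p ne e]] := toric_partner fp0 mp.
exists m'; split=> //.
have msp : perm_eq (msupp p) [:: m; m'].
  have un : uniq [:: m; m'] by rewrite /= inE eq_sym ne.
  have sub : {subset [:: m; m'] <= msupp p}.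
    by move=> a; rewrite !inE => /orP[] /eqP ->.
  rewrite perm_sym; apply: uniq_perm => //.
  by have [|_ eq_m] := uniq_min_size un sub; rewrite ?sz.
have := toric_mcoeff p (phi m); rewrite fp0 mcoeff0 (perm_big _ msp) /=.
rewrite !big_cons big_nil /= e eqxx !mulr1 addr0 pm1 => /esym/eqP.
rewrite addr_eq0 => /eqP pm'.
rewrite [p]mpolyE (perm_big _ msp) /= !big_cons big_nil addr0 pm1 scale1r.
by rewrite -[p@_m']opprK -pm' scaleN1r.
Qed.

Section Order.
Variable lt : rel 'X_{1..n}.
Hypothesis lt_irr : irreflexive lt.
Hypothesis lt_asym : forall m1 m2, lt m1 m2 -> lt m2 m1 = false.
Hypothesis lt_total : forall m1 m2, m1 != m2 -> lt m1 m2 || lt m2 m1.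

Lemma lt_neq m1 m2 : lt m1 m2 -> m2 != m1.
Proof. by apply: contraTneq => ->; rewrite lt_irr. Qed.

Lemma lead_monomial_uniq p m1 m2 :
  lead_monomial lt p m1 -> lead_monomial lt p m2 -> m1 = m2.
Proof.
move=> [m1p lt1] [m2p lt2]; apply/eqP; apply: contraT => ne.
have := lt2 m1 m1p ne; rewrite lt_asym //.
by apply: lt1 => //; rewrite eq_sym.
Qed.

Lemma lead_binomial m1 m2 : lt m2 m1 -> lead_monomial lt (mbinom (m1, m2)) m1.
Proof.
move=> lt21; have ne := lt_neq lt21; split.
  by rewrite mem_msupp_mbinom ?eqxx.
by move=> m; rewrite mem_msupp_mbinom // => /orP[] /eqP -> //; rewrite eqxx.
Qed.

Lemma normalized_binomial m1 m2 : lt m2 m1 -> normalized lt (mbinom (m1, m2)).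
Proof.
move=> lt21; exists m1; first exact: lead_binomial.
by rewrite mcoeffB !mcoeffX eqxx [m2 == m1]eq_sym (negPf (lt_neq lt21)) subr0.
Qed.

Lemma toric_normalized g : f g = 0 -> pm1_binomial g -> normalized lt g ->
  exists m1 m2, [/\ g = mbinom (m1, m2), phi m1 = phi m2 & lt m2 m1].
Proof.
move=> fg0 bg [m [mg lt_m] gm1].
have [m' [eg ne m'g e]] := toric_pm1_binomial fg0 bg gm1.
by exists m, m'; split=> //; apply: lt_m.
Qed.

(** The monomial [l] has to appear in some multiple [c * g] of a generator. The
    other term of that multiple stays in the fiber of [l], so it is [t], and
    [c] divides both [l] and [t]. *)
Lemma indispensable (G : seq {mpoly K[n]}) l t :
  {morph phi : m1 m2 / (m1 + m2)%MM} ->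
  (forall g, g \in G ->
     exists a b, [/\ g = mbinom (a, b), phi a = phi b & lt b a]) ->
  lt t l -> (forall m, phi m = phi l -> m = l \/ m = t) ->
  (forall m, (m <= l)%MM -> (m <= t)%MM -> m = 0%MM) ->
  ideal_gen (fun g => g \in G) (mbinom (l, t)) -> mbinom (l, t) \in G.
Proof.
move=> phiD Gbin lt_tl fiber coprime_lt genG.
have l_supp : l \in msupp (mbinom (l, t)).
  by rewrite mem_msupp_mbinom ?eqxx // lt_neq.
have [g [c [a [gG ag el]]]] := ideal_gen_msupp genG l_supp.
have [a1 [a2 [eg e12 lt21]]] := Gbin g gG.
have key a' b' : a' != b' -> phi a' = phi b' -> l = (c + a')%MM ->
    a' = l /\ b' = t.
  move=> ne' e' el'.
  have : phi (c + b')%MM = phi l by rewrite el' !phiD e'.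
  case/fiber => e.
    by case/eqP: ne'; apply: (@addmI _ c); rewrite e -el'.
  have c0 : c = 0%MM.
    by apply: coprime_lt; rewrite ?el' -?e lem_addr.
  by move: e el'; rewrite c0 !add0m.
have ne12 := lt_neq lt21.
move: ag; rewrite eg mem_msupp_mbinom // => /orP[] /eqP ea; subst a.
  by have [<- <-] := key _ _ ne12 e12 el; rewrite -eg.
rewrite eq_sym in ne12; have [ea2 ea1] := key _ _ ne12 (esym e12) el.
by move: lt_tl; rewrite -ea2 -ea1 lt_asym.
Qed.

(** [LT] lists the pairs (leading monomial, other monomial) of a set of
    binomials. *)
Variable LT : seq ('X_{1..n} * 'X_{1..n}).
Hypothesis LT_phi : forall mm, mm \in LT -> phi mm.1 = phi mm.2.
Hypothesis LT_lt : forall mm, mm \in LT -> lt mm.2 mm.1.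
Hypothesis LT_div : forall m m', phi m = phi m' -> lt m' m ->
  exists2 mm, mm \in LT & (mm.1 <= m)%MM.

(** Within a fiber, rewriting the larger of two distinct monomials by a binomial
    of [LT] keeps the fiber. The weight [w] makes this terminate and replaces
    well-foundedness of the order. *)
Lemma toric_generated (w : 'X_{1..n} -> nat) :
  {morph phi : m1 m2 / (m1 + m2)%MM} ->
  {morph w : m1 m2 / (m1 + m2)%MM >-> (m1 + m2)%N} ->
  (forall mm, mm \in LT -> (w mm.2 < w mm.1)%N) ->
  forall p, f p = 0 -> ideal_gen (fun g => g \in map mbinom LT) p.
Proof.
move=> phiD wD w_lt p fp0; apply: toric_span => // m1 m2.
have [N] := ubnP (w m1 + w m2); elim: N m1 m2 => // N IHN.
have step m1 m2 : (w m1 + w m2 < N.+1)%N -> phi m1 = phi m2 -> lt m2 m1 ->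
    ideal_gen (fun g => g \in map mbinom LT) (mbinom (m1, m2)).
  move=> wN e lt21; have [[l t] ltLT /= lem1] := LT_div e lt21.
  have em1 : m1 = ((m1 - l) + l)%MM by rewrite submK.
  have := w_lt _ ltLT; have := LT_phi ltLT; rewrite /= => elt wlt.
  have -> : mbinom (m1, m2) = 'X_[m1 - l] * mbinom (l, t)
              + mbinom ((m1 - l + t)%MM, m2).
    by rewrite /mbinom /= mulrBr -!mpolyXD submK // subrKA.
  apply: ideal_genD.
    by apply/ideal_genM/ideal_gen_mem/map_f.
  apply: IHN; last by rewrite phiD -elt -phiD submK.
  by move: wN; rewrite {1}em1 !wD; lia.
move=> m1 m2 wN e; have [->|ne] := eqVneq m1 m2.
  by rewrite /mbinom subrr; apply: ideal_gen0.
case/orP: (lt_total ne) => [lt12|lt21]; last exact: step.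
have -> : mbinom (m1, m2) = (-1) * mbinom (m2, m1).
  by rewrite /mbinom mulN1r opprB.
by apply/ideal_genM/step; rewrite // addnC.
Qed.

Hypothesis LT_anti : forall mm mm', mm \in LT -> mm' \in LT ->
  (mm.1 <= mm'.1)%MM -> mm = mm'.
Hypothesis LT_tail : forall mm m, mm \in LT -> phi m = phi mm.1 ->
  lt m mm.1 -> m = mm.2.

Lemma initial_lead (A : {mpoly K[n]} -> Prop) g m :
  A g -> lead_monomial lt g m -> initial_ideal lt A 'X_[m].
Proof. by move=> Ag gm; apply: ideal_gen_mem; exists g, m. Qed.

(** Monomial ideals contain a monomial only if one of their generators divides
    it. *)
Lemma initial_div (A : {mpoly K[n]} -> Prop) m : initial_ideal lt A 'X_[m] ->
  exists g m', [/\ A g, lead_monomial lt g m' & (m' <= m)%MM].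
Proof.
move=> Im.
have [|q [m1 [m2 [[g [m' [Ag gm' ->]]]]]]] := ideal_gen_msupp Im (m := m).
  by rewrite msuppX mem_head.
rewrite msuppX inE => /eqP -> em; exists g, m'; split=> //.
by rewrite em lem_addl.
Qed.

Lemma toric_lead_div p m : f p = 0 -> lead_monomial lt p m ->
  exists2 mm, mm \in LT & (mm.1 <= m)%MM.
Proof.
move=> fp0 [mp lt_m]; have [m' [m'p ne e]] := toric_partner fp0 mp.
by apply: (LT_div (esym e)); apply: lt_m.
Qed.

Lemma toric_minimal_groebner G : uniq G -> G =i map mbinom LT ->
  minimal_groebner_basis lt (fun p => f p = 0) G.
Proof.
move=> uG eG; split=> //.
- have GI g : g \in G -> f g = 0.
    by rewrite eG => /mapP[[l t] /LT_phi e ->]; apply: toric_binomial.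
  split=> // p; split; last first.
    by apply: ideal_gen_sub => q [g [m [/GI fg0 gm ->]]]; exists g, m.
  apply: ideal_gen_trans => _ [g [m [fg0 gm ->]]].
  have [[l t] ltLT /= lm] := toric_lead_div fg0 gm.
  rewrite -(submK lm) mpolyXD; apply: ideal_genM.
  apply: (@initial_lead _ (mbinom (l, t))); first by rewrite eG map_f.
  by apply/lead_binomial/(LT_lt ltLT).
- move=> g; rewrite eG => /mapP[[l t] /LT_lt lt_tl ->].
  exact: normalized_binomial.
move=> g h mg mh; rewrite !eG => /mapP[[l t] lLT ->] /mapP[[l' t'] l'LT ->] ne.
move=> /lead_monomial_uniq/(_ (lead_binomial (LT_lt lLT))) /= ->.
move=> /lead_monomial_uniq/(_ (lead_binomial (LT_lt l'LT))) /= ->.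
by apply: contra ne => /(LT_anti lLT l'LT) ->.
Qed.

(** The leading monomials of [B] and of [LT] are the minimal generators of the
    same monomial ideal; the other term of each binomial is then forced by
    [LT_tail]. *)
Lemma toric_minimal_groebner_uniq B :
  all (@pm1_binomial K n) B ->
  minimal_groebner_basis lt (fun p => f p = 0) B -> B =i map mbinom LT.
Proof.
move=> /allP Bbin [_ [BI Bgb] Bnorm Bmin].
have Bexp b : b \in B -> exists m1 m2,
    [/\ b = mbinom (m1, m2), phi m1 = phi m2 & lt m2 m1].
  move=> bB.
  by apply: toric_normalized; [apply: BI | apply: Bbin | apply: Bnorm].
have LT_B mm : mm \in LT -> mbinom mm \in B.
  case: mm => l t lLT.
  have /Bgb/initial_div[h [mh [hB hmh lemh]]] :
      initial_ideal lt (fun p => f p = 0) 'X_[l].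
    apply: (@initial_lead _ (mbinom (l, t))).
      exact: toric_binomial (LT_phi lLT).
    exact: lead_binomial (LT_lt lLT).
  have [m1 [m2 [eh e12 lt21]]] := Bexp h hB.
  have em : mh = m1.
    by apply: (lead_monomial_uniq hmh); rewrite eh; apply: lead_binomial.
  have [[l' t'] l'LT /= le'] := toric_lead_div (BI h hB) hmh.
  (* l' divides mh, which divides l: both are minimal, hence all agree. *)
  have [el' _] : (l', t') = (l, t).
    by apply: LT_anti => //=; exact: lepm_trans lemh.
  have el : m1 = l.
    apply/mnmP => i; apply/eqP; rewrite eqn_leq -em (mnm_lepP lemh) -el'.
    by rewrite (mnm_lepP le').
  have -> : t = m2.
    by symmetry; apply: (LT_tail lLT) => /=; rewrite -el.
  by rewrite -el -eh.
move=> b; apply/idP/mapP => [bB|[mm /LT_B bB ->] //].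
have [m1 [m2 [eb e12 lt21]]] := Bexp b bB.
have lead_b : lead_monomial lt b m1 by rewrite eb; apply: lead_binomial.
have [[l t] lLT /= le1] := toric_lead_div (BI b bB) lead_b.
exists (l, t) => //; apply/eqP; apply: contraT; rewrite eq_sym => ne.
have := Bmin _ _ _ _ (LT_B _ lLT) bB ne (lead_binomial (LT_lt lLT)) lead_b.
by rewrite le1.
Qed.

End Order.
End ToricIdeal.

(** * The lattice of exponent vectors *)

Section Rees.
Variables (K : fieldType) (d1 d2 u1 u2 : nat).
Hypotheses (hu1 : (0 < u1 < d1)%N) (hu2 : (0 < u2 < d2)%N).

(** The exponents of T_0 and T_1 in the binomial of the vector (j, b), counted
    on the side of X_1^j. *)
Definition xcoord (j b : int) : int := d1%:Z * b - u1%:Z * j.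
Definition ycoord (j b : int) : int := d2%:Z * (j - b) - u2%:Z * j.

(** The state of the recursion: [A] and [B] are the last binomials found with
    leading monomial T_0^x X_1^j and T_1^y X_1^j. That they span the lattice is
    what makes the mediant the next vector to consider. *)
Definition frame (jA bA jB bB : nat) : Prop :=
  [/\ [/\ (0 < jA)%N, (0 < jB)%N, (bA <= jA)%N & (bB <= jB)%N],
      [/\ 0 < xcoord jA bA, ycoord jA bA < 0,
          xcoord jB bB < 0 & 0 < ycoord jB bB]
    & forall j b : int, exists al be : int,
        j = al * jA%:Z + be * jB%:Z /\ b = al * bA%:Z + be * bB%:Z].

Lemma xcoord_comb (al be j b j' b' : int) :
  xcoord (al * j + be * j') (al * b + be * b') =
  al * xcoord j b + be * xcoord j' b'.
Proof. by rewrite /xcoord; ring. Qed.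

Lemma ycoord_comb (al be j b j' b' : int) :
  ycoord (al * j + be * j') (al * b + be * b') =
  al * ycoord j b + be * ycoord j' b'.
Proof. by rewrite /ycoord; ring. Qed.

(** Outside the open cone of [A] and [B], one of the two coefficients of a
    vector is positive and the other is not, which makes its coordinates at
    least as extreme as those of [A] or of [B]. *)
Lemma frame_regions jA bA jB bB (j b : int) :
  frame jA bA jB bB -> 0 < j ->
  [\/ exists al be : int, [/\ 1 <= al, 1 <= be,
        j = al * jA%:Z + be * jB%:Z & b = al * bA%:Z + be * bB%:Z],
      xcoord jA bA <= xcoord j b /\ ycoord j b <= ycoord jA bA
    | xcoord j b <= xcoord jB bB /\ ycoord jB bB <= ycoord j b].
Proof.
move=> [[jA0 jB0 _ _] [xA yA xB yB] span] j0.
have [al [be [ej eb]]] := span j b.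
have := xcoord_comb al be jA bA jB bB; rewrite -ej -eb => ->.
have := ycoord_comb al be jA bA jB bB; rewrite -ej -eb => ->.
move: (xcoord jA _) (xcoord jB _) (ycoord jA _) (ycoord jB _) xA xB yA yB.
move=> p q r s hp hq hr hs.
have [al1|al0] := lerP 1 al; have [be1|be0] := lerP 1 be.
- by apply: Or31; exists al, be.
- by apply: Or32; split; nia.
- by apply: Or33; split; nia.
- by exfalso; nia.
Qed.

(** The mediant is the only vector of the open cone up to its own level. *)
Lemma frame_sides jA bA jB bB (j b : int) :
  frame jA bA jB bB -> 0 < j -> j <= jA%:Z + jB%:Z ->
  [\/ j = jA%:Z + jB%:Z /\ b = bA%:Z + bB%:Z,
      xcoord jA bA <= xcoord j b /\ ycoord j b <= ycoord jA bA
    | xcoord j b <= xcoord jB bB /\ ycoord jB bB <= ycoord j b].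
Proof.
move=> fr j0 jle; have [] := frame_regions b fr j0; last 2 first.
- by move=> h; apply: Or32.
- by move=> h; apply: Or33.
case: fr => [[jA0 jB0 _ _] _ _].
move=> [al [be [al1 be1 ej eb]]]; apply: Or31.
have al_1 : al = 1 by nia.
have be_1 : be = 1 by nia.
by rewrite ej eb al_1 be_1 !mul1r.
Qed.

(** Truncated subtraction computes the positive parts of the coordinates, so
    this is divisibility of leading monomials, see [lead_dvd_le]. *)
Definition lead_dvd (V W : nat * nat) : bool :=
  [&& (V.1 <= W.1)%N,
      (d1 * V.2 - u1 * V.1 <= d1 * W.2 - u1 * W.1)%N
    & (d2 * (V.1 - V.2) - u2 * V.1 <= d2 * (W.1 - W.2) - u2 * W.1)%N].

Lemma lead_dvdE V W : (V.2 <= V.1)%N -> (W.2 <= W.1)%N ->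
  lead_dvd V W = [&& (V.1 <= W.1)%N,
    xcoord V.1 V.2 <= Num.max 0 (xcoord W.1 W.2)
    & ycoord V.1 V.2 <= Num.max 0 (ycoord W.1 W.2)].
Proof.
case: V W => [j b] [j' b'] /= h h'; rewrite /lead_dvd /xcoord /ycoord /=.
rewrite !(subzn h, subzn h').
by apply/and3P/and3P => -[*]; split; lia.
Qed.

Definition isolated V :=
  forall W, (0 < W.1)%N -> (W.2 <= W.1)%N -> lead_dvd W V -> W = V.

(** A vector beside [A] has x-coordinate at least that of [A], which exceeds
    both zero and the x-coordinate of the mediant; [B] and y are symmetric. *)
Lemma isolated_mediant jA bA jB bB : frame jA bA jB bB ->
  isolated ((jA + jB)%N, (bA + bB)%N).
Proof.
move=> fr [j b] /= j0 bj; rewrite lead_dvdE //=; last by case: fr => [[]]; lia.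
move=> /and3P[jle xle yle].
have jpos : 0 < j%:Z by lia.
have jle' : j%:Z <= jA%:Z + jB%:Z by lia.
have [[ej eb]|side|side] := frame_sides b fr jpos jle'.
  by congr pair; lia.
all: case: fr => [[jA0 jB0 _ _] [xA yA xB yB] _].
all: have := xcoord_comb 1 1 jA bA jB bB; have := ycoord_comb 1 1 jA bA jB bB.
all: rewrite !mul1r -!PoszD => ey ex; lia.
Qed.

Lemma divn_succ_bounds u d j : (0 < u < d)%N -> (0 < j)%N ->
  ((u * j.-1) %/ d <= (u * j) %/ d <= (u * j.-1) %/ d + 1)%N.
Proof.
move=> /andP[u0 ud] j0; have d0 : (0 < d)%N by lia.
rewrite leq_div2r ?leq_mul2l ?leq_pred ?orbT //=.
rewrite addn1 -ltnS ltn_divLR //.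
have := ltn_ceil (u * j.-1) d0.
have : (u * j = u + u * j.-1)%N by rewrite -mulnS prednK.
by rewrite !mulSn; lia.
Qed.

(** The quotient and remainder of the recursion locate the sign change of a
    coordinate along a level. *)
Lemma xcoord_level (j : nat) (b : int) :
  xcoord j b <= 0 -> 0 < xcoord j (b + 1) ->
  ((u1 * j) %/ d1)%:Z = b /\ ((u1 * j) %% d1)%:Z = - xcoord j b.
Proof.
rewrite /xcoord => h1 h2; have d0 : (0 < d1)%N by lia.
have := divn_eq (u1 * j) d1; have := ltn_pmod (u1 * j) d0.
move: (_ %/ _)%N (_ %% _)%N => q r rd e.
have eq_qb : q%:Z = b by nia.
by split; lia.
Qed.

Lemma ycoord_level (j : nat) (b : int) :
  ycoord j b <= 0 -> 0 < ycoord j (b - 1) ->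
  ((u2 * j) %/ d2)%:Z = j%:Z - b /\ ((u2 * j) %% d2)%:Z = - ycoord j b.
Proof.
rewrite /ycoord => h1 h2; have d0 : (0 < d2)%N by lia.
have := divn_eq (u2 * j) d2; have := ltn_pmod (u2 * j) d0.
move: (_ %/ _)%N (_ %% _)%N => q r rd e.
have eq_qb : q%:Z = j%:Z - b by nia.
by split; lia.
Qed.

(** Below the level of the mediant both coordinates change sign between the same
    two neighbours, so the two quotients add up to j - 1; and the remainders,
    being coordinates of vectors beside [A] and [B], beat no record. *)
Lemma frame_interior jA bA jB bB (j : nat) : frame jA bA jB bB ->
  (0 < j < jA + jB)%N ->
  [/\ ((u1 * j) %/ d1 + (u2 * j) %/ d2).+1 = j,
      - xcoord jB bB <= ((u1 * j) %% d1)%:Z <= d1%:Z - xcoord jA bA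
    & - ycoord jA bA <= ((u2 * j) %% d2)%:Z].
Proof.
move=> fr jlt; have d0 : (0 < d1)%N by lia.
have jpos : 0 < j%:Z by lia.
have jle : j%:Z <= jA%:Z + jB%:Z by lia.
have := frame_sides ((u1 * j) %/ d1)%N fr jpos jle.
have := frame_sides (((u1 * j) %/ d1)%:Z + 1) fr jpos jle.
case: (fr) => [_ [xA yA xB yB] _].
have := ltn_pmod (u1 * j) d0; have := divn_eq (u1 * j) d1.
move: (_ %/ _)%N (_ %% _)%N => b a e ad.
have xb : xcoord j b = - a%:Z by rewrite /xcoord; lia.
have xb1 : xcoord j (b%:Z + 1) = d1%:Z - a%:Z by rewrite /xcoord; lia.
rewrite xb xb1 => -[|h1|h1]; try lia; case=> [|h2|h2]; try lia.
have := @ycoord_level j (b%:Z + 1); rewrite addrK => -[]; try lia.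
by move=> e2 ->; split; lia.
Qed.

Lemma frame_mediant jA bA jB bB : frame jA bA jB bB ->
  let j : int := jA%:Z + jB%:Z in let b : int := bA%:Z + bB%:Z in
  [/\ xcoord jA bA <= xcoord j (b + 1), ycoord j (b + 1) <= ycoord jA bA,
      xcoord j (b - 1) <= xcoord jB bB & ycoord jB bB <= ycoord j (b - 1)].
Proof.
move=> fr j b; have [[jA0 jB0 _ _] [xA yA xB yB] _] := fr.
have jpos : 0 < j by lia.
have := frame_sides (b + 1) fr jpos (lexx _).
have := frame_sides (b - 1) fr jpos (lexx _).
have := xcoord_comb 1 1 jA bA jB bB; have := ycoord_comb 1 1 jA bA jB bB.
rewrite !mul1r -/j -/b => ey ex.
have e1 : xcoord j (b + 1) = xcoord j b + d1%:Z by rewrite /xcoord; ring.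
have e2 : xcoord j (b - 1) = xcoord j b - d1%:Z by rewrite /xcoord; ring.
have e3 : ycoord j (b + 1) = ycoord j b - d2%:Z by rewrite /ycoord; ring.
have e4 : ycoord j (b - 1) = ycoord j b + d2%:Z by rewrite /ycoord; ring.
have eb : b = bA%:Z + bB%:Z by [].
move: eb ex ey e1 e2 e3 e4; clearbody j b => eb ex ey e1 e2 e3 e4.
case=> [[_ ?]|h1|h1]; try lia; case=> [[_ ?]|h2|h2]; try lia.
by case: h1; case: h2.
Qed.

(** * The binomials attached to lattice vectors *)

Definition mon (a0 a1 b0 b1 b2 : nat) : 'X_{1..5} :=
  [multinom [tuple a0; a1; b0; b1; b2]].

Definition lead (V : nat * nat) : 'X_{1..5} :=
  mon (d1 * V.2 - u1 * V.1) (d2 * (V.1 - V.2) - u2 * V.1) 0 V.1 0.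

Definition tail (V : nat * nat) : 'X_{1..5} :=
  mon (u1 * V.1 - d1 * V.2) (u2 * V.1 - d2 * (V.1 - V.2)) V.2 0 (V.1 - V.2).

Definition gen (V : nat * nat) : {mpoly K[5]} := 'X_[lead V] - 'X_[tail V].

Lemma mpolyX_mon a0 a1 b0 b1 b2 :
  'X_[mon a0 a1 b0 b1 b2] = 'X_iT0 ^+ a0 * 'X_iT1 ^+ a1 * 'X_iX0 ^+ b0
    * 'X_iX1 ^+ b1 * 'X_iX2 ^+ b2 :> {mpoly K[5]}.
Proof.
rewrite mpolyXE_id !big_ord_recr big_ord0 /= mul1r.
by congr (_ * _ * _ * _ * _); congr (_ ^+ _); rewrite ?multinomE;
  congr 'X_ _; apply: val_inj.
Qed.

(** Stated with the exponents as parameters, since each case of the recursion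
    writes the same positive and negative parts in its own way. *)
Lemma gen_mon j b (p q r s c : nat) : (b <= j)%N -> j%:Z - b%:Z = c%:Z ->
  p%:Z = Num.max 0 (xcoord j b) -> q%:Z = Num.max 0 (ycoord j b) ->
  r%:Z = Num.max 0 (- xcoord j b) -> s%:Z = Num.max 0 (- ycoord j b) ->
  gen (j, b) = 'X_[mon p q 0 j 0] - 'X_[mon r s b 0 c].
Proof.
move=> bj ec; rewrite /gen /lead /tail /xcoord /ycoord /= subzn //.
move=> ep eq er es.
by congr ('X_[mon _ _ _ _ _] - 'X_[mon _ _ _ _ _]); lia.
Qed.

(** * The recursion as a mediant process *)

(** What completeness still requires once [A] and [B] are reached: vectors
    outside the open cone have been dealt with before. *)
Definition dominated (Vs : seq (nat * nat)) jA bA jB bB : Prop :=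
  forall (al be : int) (W : nat * nat), 1 <= al -> 1 <= be ->
    W.1%:Z = al * jA%:Z + be * jB%:Z -> W.2%:Z = al * bA%:Z + be * bB%:Z ->
    (W.2 <= W.1)%N -> exists2 V, V \in Vs & lead_dvd V W.

Lemma mediant_coords jA bA jB bB :
  xcoord (jA + jB)%N (bA + bB)%N = xcoord jA bA + xcoord jB bB /\
  ycoord (jA + jB)%N (bA + bB)%N = ycoord jA bA + ycoord jB bB.
Proof.
have := xcoord_comb 1 1 jA bA jB bB; have := ycoord_comb 1 1 jA bA jB bB.
by rewrite !mul1r.
Qed.

Lemma frame_left jA bA jB bB : frame jA bA jB bB ->
  ycoord (jA + jB)%N (bA + bB)%N < 0 -> 0 < xcoord (jA + jB)%N (bA + bB)%N ->
  frame (jA + jB) (bA + bB) jB bB.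
Proof.
move=> [[jA0 jB0 hA hB] [xA yA xB yB] span] yV xV.
split=> [||j b]; [by split; lia | by split |].
have [al [be [-> ->]]] := span j b.
by exists al, (be - al); rewrite !PoszD; split; ring.
Qed.

Lemma frame_right jA bA jB bB : frame jA bA jB bB ->
  0 < ycoord (jA + jB)%N (bA + bB)%N -> xcoord (jA + jB)%N (bA + bB)%N < 0 ->
  frame jA bA (jA + jB) (bA + bB).
Proof.
move=> [[jA0 jB0 hA hB] [xA yA xB yB] span] yV xV.
split=> [||j b]; [by split; lia | by split |].
have [al [be [-> ->]]] := span j b.
by exists (al - be), be; rewrite !PoszD; split; ring.
Qed.

Lemma dominated_comb jA bA jB bB (al be : int) (W V : nat * nat) :
  W.1%:Z = al * jA%:Z + be * jB%:Z -> W.2%:Z = al * bA%:Z + be * bB%:Z ->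
  (V.2 <= V.1)%N -> (W.2 <= W.1)%N ->
  [/\ (V.1 <= W.1)%N,
    xcoord V.1 V.2 <= Num.max 0 (al * xcoord jA bA + be * xcoord jB bB)
    & ycoord V.1 V.2 <= Num.max 0 (al * ycoord jA bA + be * ycoord jB bB)] ->
  lead_dvd V W.
Proof.
move=> e1 e2 hV hW; rewrite lead_dvdE // e1 e2.
by rewrite xcoord_comb ycoord_comb => -[-> -> ->].
Qed.

(** The mediant [V] splits the cone. Between [A] and [V], the x-coordinate is at
    least that of [V] and the y-coordinate has no positive part, so [V] divides;
    the cone of [V] and [B] is left to the hypothesis. *)
Lemma dominated_left jA bA jB bB Vs : frame jA bA jB bB ->
  ycoord (jA + jB)%N (bA + bB)%N <= 0 -> 0 < xcoord (jA + jB)%N (bA + bB)%N ->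
  (jA + jB, bA + bB)%N \in Vs ->
  dominated Vs (jA + jB) (bA + bB) jB bB -> dominated Vs jA bA jB bB.
Proof.
move=> fr yV xV VVs dom al be W al1 be1 e1 e2 hW.
have [[jA0 jB0 hA hB] [xA yA xB yB] span] := fr.
have [ex ey] := mediant_coords jA bA jB bB.
have [lt_al_be|le_be_al] := ltrP al be.
  apply: (dom al (be - al)) => //; first lia.
    by rewrite e1 PoszD; ring.
  by rewrite e2 PoszD; ring.
exists ((jA + jB)%N, (bA + bB)%N) => //.
apply: (dominated_comb e1 e2) => //=; first lia.
rewrite ex ey; split; nia.
Qed.

Lemma dominated_right jA bA jB bB Vs : frame jA bA jB bB ->
  xcoord (jA + jB)%N (bA + bB)%N <= 0 -> 0 < ycoord (jA + jB)%N (bA + bB)%N ->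
  (jA + jB, bA + bB)%N \in Vs ->
  dominated Vs jA bA (jA + jB) (bA + bB) -> dominated Vs jA bA jB bB.
Proof.
move=> fr xV yV VVs dom al be W al1 be1 e1 e2 hW.
have [[jA0 jB0 hA hB] [xA yA xB yB] span] := fr.
have [ex ey] := mediant_coords jA bA jB bB.
have [lt_be_al|le_al_be] := ltrP be al.
  apply: (dom (al - be) be) => //; first lia.
    by rewrite e1 PoszD; ring.
  by rewrite e2 PoszD; ring.
exists ((jA + jB)%N, (bA + bB)%N) => //.
apply: (dominated_comb e1 e2) => //=; first lia.
rewrite ex ey; split; nia.
Qed.

Lemma dominated_pure jA bA jB bB Vs : frame jA bA jB bB ->
  xcoord (jA + jB)%N (bA + bB)%N <= 0 -> ycoord (jA + jB)%N (bA + bB)%N <= 0 ->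
  (jA + jB, bA + bB)%N \in Vs -> dominated Vs jA bA jB bB.
Proof.
move=> fr xV yV VVs al be W al1 be1 e1 e2 hW.
have [[jA0 jB0 hA hB] _ _] := fr.
exists ((jA + jB)%N, (bA + bB)%N) => //.
apply: (dominated_comb e1 e2) => //=; first lia.
by split; [nia | rewrite le_max xV | rewrite le_max yV].
Qed.

(** When the mediant is positive in both coordinates, it dominates the vectors
    whose two coefficients agree; otherwise the surplus of [A] or of [B] makes
    that edge dominate. *)
Lemma dominated_mixed jA bA jB bB Vs : frame jA bA jB bB ->
  0 < xcoord (jA + jB)%N (bA + bB)%N -> 0 < ycoord (jA + jB)%N (bA + bB)%N ->
  (jA, bA) \in Vs -> (jB, bB) \in Vs ->
  (jA + jB, bA + bB)%N \in Vs -> dominated Vs jA bA jB bB.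
Proof.
move=> fr xV yV AVs BVs VVs al be W al1 be1 e1 e2 hW.
have [[jA0 jB0 hA hB] [xA yA xB yB] span] := fr.
have [ex ey] := mediant_coords jA bA jB bB.
rewrite ex in xV; rewrite ey in yV.
have [lt_al_be|lt_be_al|eq_al_be] := ltrgtP al be.
- exists (jB, bB) => //; apply: (dominated_comb e1 e2) => //=; split; nia.
- exists (jA, bA) => //; apply: (dominated_comb e1 e2) => //=; split; nia.
exists ((jA + jB)%N, (bA + bB)%N) => //.
apply: (dominated_comb e1 e2) => //=; first lia.
rewrite ex ey; split; nia.
Qed.

(** If one edge of the cone has y = 0, the y-coordinates in the cone come from
    the other edge alone, which therefore dominates and lets the recursion
    stop. *)
Lemma dominated_axis_right (jA bA jB bB : nat) Vs :
  (0 < jA)%N -> (bB <= jB)%N ->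
  ycoord jA bA = 0 -> xcoord jB bB <= 0 -> 0 <= ycoord jB bB ->
  (jB, bB) \in Vs -> dominated Vs jA bA jB bB.
Proof.
move=> jA0 hB yA xB yB BVs al be W al1 be1 e1 e2 hW.
exists (jB, bB) => //; apply: (dominated_comb e1 e2) => //=.
by rewrite yA; split; nia.
Qed.

Lemma dominated_axis_left (jA bA jB bB : nat) Vs :
  (0 < jB)%N -> (bA <= jA)%N ->
  xcoord jB bB = 0 -> ycoord jA bA <= 0 -> 0 <= xcoord jA bA ->
  (jA, bA) \in Vs -> dominated Vs jA bA jB bB.
Proof.
move=> jB0 hA xB yA xA AVs al be W al1 be1 e1 e2 hW.
exists (jA, bA) => //; apply: (dominated_comb e1 e2) => //=.
by rewrite xB; split; nia.
Qed.

(** Each quotient grows by at most one per level, so the cases of the recursion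
    are recognized from the sum of the two quotients alone. *)
Lemma increments_none b1 b1' b2 b2' :
  (b1' <= b1 <= b1' + 1)%N -> (b2' <= b2 <= b2' + 1)%N ->
  (b1 - b1' == 0)%N && (b2 - b2' == 0)%N = (b1 + b2 == b1' + b2')%N.
Proof. by lia. Qed.

Lemma increments_both b1 b1' b2 b2' :
  (b1' <= b1 <= b1' + 1)%N -> (b2' <= b2 <= b2' + 1)%N ->
  (b1 - b1' == 1)%N && (b2 - b2' == 1)%N = (b1 + b2 == (b1' + b2').+2)%N.
Proof. by lia. Qed.

(** The records are M1 = d1 - x(A), m1 = - x(B), M2 = d2 - y(B), m2 = - y(A). On
    the level j of the mediant, the sum of the quotients is j, j - 1 or j - 2
    according to the signs of its coordinates, and this selects the case of the
    recursion. The fuel suffices since u1 d1 = 0 mod d1 stops the recursion on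
    level d1 at the latest. *)
Lemma rees_loop_frame fuel j jA bA jB bB (M1 m1 M2 m2 : nat) :
  frame jA bA jB bB -> (d1 < j + fuel)%N -> (1 < j <= d1)%N ->
  (j <= jA + jB)%N ->
  M1%:Z = d1%:Z - xcoord jA bA -> m1%:Z = - xcoord jB bB ->
  M2%:Z = d2%:Z - ycoord jB bB -> m2%:Z = - ycoord jA bA -> (m1 <= M1)%N ->
  exists Vs : seq (nat * nat),
  [/\ rees_loop K d1 d2 u1 u2 fuel j M1 m1 M2 m2 = map gen Vs,
      path ltn j.-1 (map fst Vs),
      forall V : nat * nat, V \in Vs -> (V.2 <= V.1)%N /\ isolated V
    & dominated [:: (jA, bA), (jB, bB) & Vs] jA bA jB bB].
Proof.
elim: fuel j jA bA jB bB M1 m1 M2 m2 => [|fuel IH] j jA bA jB bB M1 m1 M2 m2.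
  by move=> _; lia.
move=> fr fuel_ok jd1 jle eM1 em1 eM2 em2 mM1 /=.
have j0 : (0 < j)%N by lia.
have [[jA0 jB0 hA hB] [xA yA xB yB] span] := fr.
have a1d1 : ((u1 * j) %% d1 != 0)%N -> (j < d1)%N.
  move=> a1; rewrite ltn_neqAle andbC; case/andP: jd1 => _ ->.
  by apply: contraNneq a1 => ->; rewrite modnMl.
have prev : ((u1 * j.-1) %/ d1 + (u2 * j.-1) %/ d2).+1 = j.-1.
  by case: (@frame_interior jA bA jB bB j.-1) => //; lia.
rewrite increments_none ?increments_both; try exact: divn_succ_bounds.
have interior := @frame_interior jA bA jB bB j fr.
have xlevel := @xcoord_level j; have ylevel := @ycoord_level j.
move: prev a1d1 interior xlevel ylevel.
move: (_ %/ d1)%N (_ %/ d1)%N (_ %/ d2)%N (_ %/ d2)%N => b1 b1' b2 b2'.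
move: (_ %% d1)%N (_ %% d2)%N => a1 a2 prev a1d1 interior xlevel ylevel.
have [jlt|jge] := ltnP j (jA + jB).
  have [|sumb ha1 ha2] := interior; first by rewrite j0.
  have -> : (b1 + b2 == b1' + b2')%N = false by lia.
  have -> : (b1 + b2 == (b1' + b2').+2)%N = false by lia.
  have [|||Vs [e1 e2 e3 e4]] :=
    IH j.+1 jA bA jB bB M1 m1 M2 m2 fr _ _ _ eM1 em1 eM2 em2 mM1; try lia.
  have -> : (a1 == 0)%N || (a2 == 0)%N = false by lia.
  have -> : (M1 < a1)%N = false by lia.
  have -> : (a1 < m1)%N = false by lia.
  exists Vs; split=> //.
  by apply: (path_le ltn_trans _ e2); lia.
have ej : j = (jA + jB)%N by lia.
have := frame_mediant fr; rewrite -!PoszD -ej /=.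
have [ex ey] := mediant_coords jA bA jB bB.
have := isolated_mediant fr; rewrite -ej in ex ey *.
have [b eb] : exists b, (bA + bB)%N = b by exists (bA + bB)%N.
rewrite eb in ex ey *.
move=> isoV [x_next y_next x_prev y_prev].
have hV : (b <= j)%N by lia.
have sound1 V : V \in [:: (j, b)] -> (V.2 <= V.1)%N /\ isolated V.
  by rewrite inE => /eqP ->.
have path1 : path ltn j.-1 (map fst [:: (j, b)]) by rewrite /= andbT prednK.
have [xV|xV] := lerP (xcoord j b) 0; have [yV|yV] := lerP (ycoord j b) 0.
- have [|| eb1 ea1] := xlevel b; try lia.
  have [|| eb2 ea2] := ylevel b; try lia.
  have -> : (b1 + b2 == b1' + b2')%N = false by lia.
  have -> : (b1 + b2 == (b1' + b2').+2)%N by lia.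
  exists [:: (j, b)]; split=> //.
    rewrite /= (@gen_mon j b 0%N 0%N a1 a2 b2); try lia.
    rewrite !mpolyX_mon !expr0 !mul1r !mulr1.
    by have -> : b = b1 by lia.
  apply: dominated_pure => //; rewrite -?ej ?eb //.
  by rewrite !inE eqxx !orbT.
- (* The mediant replaces B; if x = 0, then A dominates what remains. *)
  have [|| eb1 ea1] := xlevel b; try lia.
  have [|| eb2 ea2] := ylevel (b%:Z + 1); rewrite ?addrK; try lia.
  have ycr : ycoord j (b%:Z + 1) = ycoord j b - d2%:Z by rewrite /ycoord; ring.
  have -> : (b1 + b2 == b1' + b2')%N = false by lia.
  have -> : (b1 + b2 == (b1' + b2').+2)%N = false by lia.
  have -> : (M1 < a1)%N = false by lia.
  have -> : (a1 < m1)%N by lia.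
  have -> : (M2 < a2)%N by lia.
  have egen : gen (j, b) = 'X_iT1 ^+ (d2 - a2) * 'X_iX1 ^+ j
              - 'X_iT0 ^+ a1 * 'X_iX0 ^+ b1 * 'X_iX2 ^+ b2.+1.
    rewrite /= (@gen_mon j b 0%N (d2 - a2)%N a1 0%N b2.+1); try lia.
    rewrite !mpolyX_mon !expr0 !mul1r !mulr1.
    by have -> : b = b1 by lia.
  have [xV0|xV0] := eqVneq (xcoord j b) 0.
    have -> : (a1 == 0)%N || (a2 == 0)%N by lia.
    exists [:: (j, b)]; split=> //; first by rewrite /= egen.
    apply: dominated_right => //; rewrite -?ej ?eb //.
      by rewrite !inE eqxx !orbT.
    apply: dominated_axis_left; try lia.
    by rewrite !inE eqxx.
  have -> : (a1 == 0)%N || (a2 == 0)%N = false by lia.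
  have fr' : frame jA bA j b.
    by rewrite ej -eb; apply: frame_right; rewrite -?ej ?eb //; lia.
  have [||||||||Vs [e1 e2 e3 e4]] :=
    IH j.+1 jA bA j b M1 a1 a2 m2 fr'; try lia.
  exists ((j, b) :: Vs); split.
  + by rewrite /= egen e1.
  + by rewrite /= prednK ?leqnn.
  + by move=> V; rewrite inE => /orP[/eqP -> //|]; apply: e3.
  apply: dominated_right; rewrite -?ej ?eb //.
    by rewrite !inE eqxx !orbT.
  move=> al be W al1 be1 eW1 eW2 hW.
  have [V VVs VW] := e4 al be W al1 be1 eW1 eW2 hW.
  exists V => //; move: VVs; rewrite !inE.
  by case/or3P => ->; rewrite ?orbT.
- (* The mediant replaces A; if y = 0, then B dominates what remains. *)
  have [|| eb1 ea1] := xlevel (b%:Z - 1); rewrite ?subrK; try lia.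
  have [|| eb2 ea2] := ylevel b; try lia.
  have xcr : xcoord j (b%:Z - 1) = xcoord j b - d1%:Z by rewrite /xcoord; ring.
  have -> : (b1 + b2 == b1' + b2')%N = false by lia.
  have -> : (b1 + b2 == (b1' + b2').+2)%N = false by lia.
  have -> : (M1 < a1)%N by lia.
  have -> : (a2 < m2)%N by lia.
  have egen : gen (j, b) = 'X_iT0 ^+ (d1 - a1) * 'X_iX1 ^+ j
              - 'X_iT1 ^+ a2 * 'X_iX0 ^+ b1.+1 * 'X_iX2 ^+ b2.
    rewrite /= (@gen_mon j b (d1 - a1)%N 0%N 0%N a2 b2); try lia.
    rewrite !mpolyX_mon !expr0 !mul1r !mulr1.
    by have -> : b = b1.+1 by lia.
  have [yV0|yV0] := eqVneq (ycoord j b) 0.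
    have -> : (a1 == 0)%N || (a2 == 0)%N by lia.
    exists [:: (j, b)]; split=> //; first by rewrite /= egen.
    apply: dominated_left => //; rewrite -?ej ?eb //.
      by rewrite !inE eqxx !orbT.
    apply: dominated_axis_right; try lia.
    by rewrite !inE eqxx orbT.
  have -> : (a1 == 0)%N || (a2 == 0)%N = false by lia.
  have fr' : frame j b jB bB.
    by rewrite ej -eb; apply: frame_left; rewrite -?ej ?eb //; lia.
  have [||||||||Vs [e1 e2 e3 e4]] :=
    IH j.+1 j b jB bB a1 m1 M2 a2 fr'; try lia.
  exists ((j, b) :: Vs); split.
  + by rewrite /= egen e1.
  + by rewrite /= prednK ?leqnn.
  + by move=> V; rewrite inE => /orP[/eqP -> //|]; apply: e3.
  apply: dominated_left; rewrite -?ej ?eb //.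
    by rewrite !inE eqxx !orbT.
  move=> al be W al1 be1 eW1 eW2 hW.
  have [V VVs VW] := e4 al be W al1 be1 eW1 eW2 hW.
  exists V => //; move: VVs; rewrite !inE.
  by case/or3P => ->; rewrite ?orbT.
- have [|| eb1 ea1] := xlevel (b%:Z - 1); rewrite ?subrK; try lia.
  have [|| eb2 ea2] := ylevel (b%:Z + 1); rewrite ?addrK; try lia.
  have ycr : ycoord j (b%:Z + 1) = ycoord j b - d2%:Z by rewrite /ycoord; ring.
  have xcr : xcoord j (b%:Z - 1) = xcoord j b - d1%:Z by rewrite /xcoord; ring.
  have -> : (b1 + b2 == b1' + b2')%N by lia.
  exists [:: (j, b)]; split=> //.
    rewrite /= (@gen_mon j b (d1 - a1)%N (d2 - a2)%N 0%N 0%N b2.+1); try lia.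
    rewrite !mpolyX_mon !expr0 !mul1r !mulr1.
    by have -> : b = b1.+1 by lia.
  apply: dominated_mixed => //; rewrite -?ej ?eb //.
  all: by rewrite !inE eqxx ?orbT.
Qed.

(** * Monomials with the same image *)

Lemma monE a0 a1 b0 b1 b2 :
  (mon a0 a1 b0 b1 b2 iT0 = a0) * (mon a0 a1 b0 b1 b2 iT1 = a1) *
  (mon a0 a1 b0 b1 b2 iX0 = b0) * (mon a0 a1 b0 b1 b2 iX1 = b1) *
  (mon a0 a1 b0 b1 b2 iX2 = b2).
Proof. by rewrite !multinomE. Qed.

Lemma forall_ord5 (P : 'I_5 -> Prop) :
  (forall i, P i) <-> [/\ P iT0, P iT1, P iX0, P iX1 & P iX2].
Proof.
split=> [Pi | [p0 p1 p2 p3 p4] [i i5]]; first by split.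
move: i i5 => [|[|[|[|[|//]]]]] i5.
- by rewrite (_ : Ordinal i5 = iT0) //; apply: val_inj.
- by rewrite (_ : Ordinal i5 = iT1) //; apply: val_inj.
- by rewrite (_ : Ordinal i5 = iX0) //; apply: val_inj.
- by rewrite (_ : Ordinal i5 = iX1) //; apply: val_inj.
by rewrite (_ : Ordinal i5 = iX2) //; apply: val_inj.
Qed.

Lemma mnm_eq5 (m m' : 'X_{1..5}) : m = m' <->
  [/\ m iT0 = m' iT0, m iT1 = m' iT1, m iX0 = m' iX0, m iX1 = m' iX1
    & m iX2 = m' iX2].
Proof. by rewrite -(forall_ord5 (fun i => m i = m' i)); apply: mnmP. Qed.

Lemma mnm_le5 (m m' : 'X_{1..5}) : (m <= m')%MM <->
  [/\ m iT0 <= m' iT0, m iT1 <= m' iT1, m iX0 <= m' iX0, m iX1 <= m' iX1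
    & m iX2 <= m' iX2]%N.
Proof.
rewrite -(forall_ord5 (fun i => m i <= m' i)%N).
by split=> [/mnm_lepP //|?]; apply/mnm_lepP.
Qed.

(** The exponent vector of the image of a monomial, see [rees_mapX]. *)
Definition rees_exp (m : 'X_{1..5}) : 'X_{1..3} :=
  [multinom [tuple (m iT0 + d1 * m iX0 + u1 * m iX1)%N;
                   (m iT1 + u2 * m iX1 + d2 * m iX2)%N;
                   (m iX0 + m iX1 + m iX2)%N]].

Lemma rees_exp_eq m m' : rees_exp m = rees_exp m' <->
  [/\ m iT0 + d1 * m iX0 + u1 * m iX1 = m' iT0 + d1 * m' iX0 + u1 * m' iX1,
      m iT1 + u2 * m iX1 + d2 * m iX2 = m' iT1 + u2 * m' iX1 + d2 * m' iX2
    & m iX0 + m iX1 + m iX2 = m' iX0 + m' iX1 + m' iX2]%N.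
Proof.
split=> [/(congr1 val)/(congr1 val) /= [-> -> ->] //|[e0 e1 e2]].
by apply/val_inj/val_inj => /=; rewrite e0 e1 e2.
Qed.

Lemma rees_expE m i : rees_exp m i = nth 0%N
  [:: (m iT0 + d1 * m iX0 + u1 * m iX1)%N; (m iT1 + u2 * m iX1 + d2 * m iX2)%N;
      (m iX0 + m iX1 + m iX2)%N] i.
Proof. by rewrite multinomE (tnth_nth 0%N). Qed.

Lemma rees_expD : {morph rees_exp : m1 m2 / (m1 + m2)%MM}.
Proof.
move=> m m'; apply/mnmP => i; rewrite mnmDE !rees_expE !mnmDE.
by case: i => [[|[|[|//]]] i3] /=; lia.
Qed.

Lemma mpolyX3 (m : 'X_{1..3}) :
  'X_[m] = 'X_(Ordinal (isT : (0 < 3)%N)) ^+ m (Ordinal (isT : (0 < 3)%N))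
         * 'X_(Ordinal (isT : (1 < 3)%N)) ^+ m (Ordinal (isT : (1 < 3)%N))
         * 'X_(Ordinal (isT : (2 < 3)%N)) ^+ m (Ordinal (isT : (2 < 3)%N))
  :> {mpoly K[3]}.
Proof.
rewrite mpolyXE_id !big_ord_recr big_ord0 /= mul1r.
by congr (_ * _ * _); congr ('X_ _ ^+ m _); apply: val_inj.
Qed.

Lemma mon_eta (m : 'X_{1..5}) : m = mon (m iT0) (m iT1) (m iX0) (m iX1) (m iX2).
Proof. by apply/mnm_eq5; rewrite !monE. Qed.

Lemma rees_mapX m :
  @rees_map K d1 d2 u1 u2 'X_[m] = 'X_[rees_exp m].
Proof.
rewrite {1}[m]mon_eta mpolyX_mon /rees_map !rmorphM !rmorphXn /= !comp_mpolyXU.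
rewrite [RHS]mpolyX3 !rees_expE /=.
by rewrite /tnth /= !exprMn -!exprM !exprD; ring.
Qed.

(** The order in terms of single exponents, a form that linear arithmetic
    decides. *)
Lemma precE m m' : prec m m' =
  let s := (m iX2 + m iX0 + m iX1)%N in
  let s' := (m' iX2 + m' iX0 + m' iX1)%N in
  let t := (m iT0 + m iT1)%N in let t' := (m' iT0 + m' iT1)%N in
  [|| (s < s'),
      (s == s') && [|| m' iX2 < m iX2,
        (m' iX2 == m iX2) && (m' iX0 < m iX0)
      | [&& m' iX2 == m iX2, m' iX0 == m iX0 & m' iX1 < m iX1]]
    | [&& m iX2 == m' iX2, m iX0 == m' iX0, m iX1 == m' iX1 &
        (t < t') || (t == t') && ((m' iT0 < m iT0) ||
          (m' iT0 == m iT0) && (m' iT1 < m iT1))]]%N.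
Proof.
rewrite /prec /drl /Xexps /Texps /= !eqseq_cons eqxx.
rewrite !addn0 !addnA !andbT !andbF !orbF.
by case: (m' iX2 == m iX2); rewrite /= ?andbF ?orbF // -?andbA -?orbA.
Qed.

Lemma prec_irr : irreflexive prec.
Proof. by move=> m; rewrite precE /=; lia. Qed.

Lemma prec_asym m1 m2 : prec m1 m2 -> prec m2 m1 = false.
Proof. by rewrite !precE /=; lia. Qed.

Lemma prec_total m1 m2 : m1 != m2 -> prec m1 m2 || prec m2 m1.
Proof.
rewrite !precE /= => ne; apply: contraR ne => nlt; apply/eqP/mnm_eq5.
by split; lia.
Qed.

Definition lead0 : 'X_{1..5} := mon 0 d2 1 0 0.
Definition tail0 : 'X_{1..5} := mon d1 0 0 0 1.

(** Comparing the X-parts, m has the smaller exponent of X_2 or, that being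
    equal, of X_0. If it has more X_0 than m', then the balance of T_1 costs m
    at least d2 factors T_1. Otherwise the exponent differences of X_1 and X_0
    form the vector sought. *)
Lemma fiber_div m m' : rees_exp m = rees_exp m' -> prec m' m ->
  (lead0 <= m)%MM \/
  exists W : nat * nat, [/\ (0 < W.1)%N, (W.2 <= W.1)%N
    & (lead W <= m)%MM].
Proof.
move=> /rees_exp_eq[e0 e1 e2]; rewrite precE /= => lt_m'm.
have {lt_m'm} lt_m'm :
    (m iX2 < m' iX2)%N \/ (m iX2 = m' iX2 /\ (m iX0 < m' iX0)%N).
  have [/and3P[/eqP x2 /eqP x0 /eqP x1]|] :=
    boolP [&& m iX2 == m' iX2, m iX0 == m' iX0 & m iX1 == m' iX1].
    by move: e0 e1 lt_m'm; rewrite x0 x1 x2; lia.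
  by lia.
have [b_neg|b_pos] := ltnP (m' iX0) (m iX0).
  left; apply/mnm_le5; rewrite !monE; split=> //; last by lia.
  by nia.
right; exists ((m iX1 - m' iX1)%N, (m' iX0 - m iX0)%N).
rewrite /lead /=; split; [lia | lia |].
by apply/mnm_le5; rewrite !monE; split; nia.
Qed.

Lemma rees_exp_lead_tail (V : nat * nat) : (V.2 <= V.1)%N ->
  rees_exp (lead V) = rees_exp (tail V).
Proof.
move=> hV; apply/rees_exp_eq; rewrite /lead /tail !monE; split; last by lia.
  by rewrite muln0 addn0; lia.
by rewrite !muln0 !addn0; lia.
Qed.

Lemma lead_dvd_le V W :
  (lead V <= lead W)%MM <-> lead_dvd V W.
Proof.
rewrite /lead_dvd; split=> [/mnm_le5|/and3P[h1 h2 h3]].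
  by rewrite /lead !monE => -[-> -> _ -> _].
by apply/mnm_le5; rewrite /lead !monE.
Qed.

Lemma prec_lead_tail (V : nat * nat) : (0 < V.1)%N -> (V.2 <= V.1)%N ->
  prec (tail V) (lead V).
Proof. by move=> V0 hV; rewrite precE /lead /tail !monE /=; lia. Qed.

(** A monomial in the fiber differs from [lead V] by a lattice vector whose
    leading monomial divides [lead V], as [lead V] contains neither X_0 nor
    X_2; isolation leaves only zero and [V]. *)
Lemma isolated_fiber V m : (V.2 <= V.1)%N -> isolated V ->
  rees_exp m = rees_exp (lead V) -> m = lead V \/ m = tail V.
Proof.
move=> hV isoV /rees_exp_eq; rewrite /lead /tail !monE !muln0 !addn0 !add0n.
move=> [e0 e1 e2].
have [eX1|ltX1] := eqVneq (m iX1) V.1.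
  left; have [z0 z2] : m iX0 = 0%N /\ m iX2 = 0%N by lia.
  apply/mnm_eq5; rewrite !monE.
  by move: e0 e1; rewrite z0 z2 eX1; split; lia.
right; have eV : ((V.1 - m iX1)%N, m iX0) = V.
  apply: isoV => /=; [lia | lia |].
  apply/and3P; split=> /=; first by lia.
    by rewrite mulnBr; lia.
  rewrite (_ : (V.1 - m iX1 - m iX0)%N = m iX2); last by lia.
  by rewrite mulnBr; nia.
have /(congr1 fst) /= eV1 := eV; have /(congr1 snd) /= x0 := eV.
have x1 : m iX1 = 0%N by lia.
have x2 : m iX2 = (V.1 - V.2)%N by lia.
apply/mnm_eq5; rewrite !monE x0 x1 x2.
by move: e0 e1; rewrite x0 x1 x2; split; lia.
Qed.

(** The fiber also contains T_0^(d1-u1) T_1^(d2-u2) X_1, but this monomial is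
    larger than the leading monomial of g_0. *)
Lemma tail0_unique m : rees_exp m = rees_exp lead0 -> prec m lead0 -> m = tail0.
Proof.
rewrite precE => /rees_exp_eq.
rewrite /lead0 /tail0 !monE !muln0 !muln1 !addn0 !add0n /=.
move=> [e0 e1 e2] lt; apply/mnm_eq5; rewrite !monE.
have [x0 x1] : m iX0 = 0%N /\ m iX1 = 0%N.
  have [x0|x0] : m iX0 = 0%N \/ m iX0 = 1%N by lia.
    by split=> //; lia.
  have [x1 x2] : m iX1 = 0%N /\ m iX2 = 0%N by lia.
  by move: e0 e1 lt; rewrite x0 x1 x2; lia.
have x2 : m iX2 = 1%N by lia.
by move: e0 e1; rewrite x0 x1 x2; split; lia.
Qed.

Lemma lead_tail_coprime V m : (m <= lead V)%MM ->
  (m <= tail V)%MM -> m = 0%MM.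
Proof.
move=> /mnm_le5 + /mnm_le5; rewrite /lead /tail !monE.
move=> [l0 l1 l2 l3 l4] [t0 t1 t2 t3 t4].
by apply/mnm_eq5; rewrite !mnm0E; split; lia.
Qed.

Lemma rees_ideal_gen (A : {mpoly K[5]} -> Prop) p :
  (forall q, A q -> rees_ideal d1 d2 u1 u2 q) -> ideal_gen A p ->
  rees_ideal d1 d2 u1 u2 p.
Proof.
move=> AR [s sA ->]; rewrite /rees_ideal /rees_map raddf_sum big_seq.
rewrite big1 // => x xs.
by rewrite /= rmorphM /= [X in _ * X](AR _ (sA x xs)) mulr0.
Qed.

(** * The generators as isolated lattice vectors *)

Lemma xcoord_init : (xcoord 1 1 = d1%:Z - u1%:Z) * (xcoord 1 0 = - u1%:Z).
Proof. by rewrite /xcoord; split; ring. Qed.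

Lemma ycoord_init : (ycoord 1 1 = - u2%:Z) * (ycoord 1 0 = d2%:Z - u2%:Z).
Proof. by rewrite /ycoord; split; ring. Qed.

Lemma frame_init : frame 1 1 1 0.
Proof.
split=> [|| j b]; first by [].
  by rewrite !xcoord_init !ycoord_init; split; lia.
by exists b, (j - b); split; ring.
Qed.

(** The first two generators come from (1, 1) and (1, 0), which form the initial
    frame. The remaining levels strictly increase, hence no repetition. *)
Lemma rees_gens_lattice : exists Vs : seq (nat * nat),
  [/\ rees_gens K d1 d2 u1 u2 = map gen Vs, uniq Vs,
      forall V : nat * nat, V \in Vs ->
        [/\ (0 < V.1)%N, (V.2 <= V.1)%N & isolated V]
    & forall W, (0 < W.1)%N -> (W.2 <= W.1)%N ->
        exists2 V, V \in Vs & lead_dvd V W].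
Proof.
have [||||||||Vs [eVs pVs sound dom]] := rees_loop_frame
  (fuel := d1) (j := 2) (M1 := u1) (m1 := u1) (M2 := u2) (m2 := u2) frame_init;
  rewrite ?xcoord_init ?ycoord_init; try lia.
exists [:: (1, 1)%N, (1, 0)%N & Vs]; split.
- rewrite /rees_gens eVs /=; congr [:: _, _ & _].
    rewrite (@gen_mon 1 1 (d1 - u1)%N 0%N 0%N u2 0%N);
      rewrite ?xcoord_init ?ycoord_init; try lia.
    by rewrite !mpolyX_mon !expr0 !expr1 !mul1r !mulr1.
  rewrite (@gen_mon 1 0 0%N (d2 - u2)%N u1 0%N 1%N);
    rewrite ?xcoord_init ?ycoord_init; try lia.
  by rewrite !mpolyX_mon !expr0 !expr1 !mul1r !mulr1.
- have Vs1 V : V \in Vs -> (1 < V.1)%N.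
    move=> VVs; have := pVs; rewrite path_sortedE; last exact: ltn_trans.
    by move=> /andP[/allP/(_ V.1)/(_ (map_f _ VVs))].
  rewrite /= !inE /=; apply/and3P; split.
  + by apply/negP => /Vs1.
  + by apply/negP => /Vs1.
  apply: (@map_uniq _ _ fst).
  by apply: sorted_uniq (path_sorted pVs); [apply: ltn_trans | apply: ltnn].
- move=> V; rewrite !inE => /or3P[/eqP ->|/eqP ->|VVs].
  + split=> // -[j b] /= j0 bj /and3P[/= h1 _ h3].
    have ej : j = 1%N by lia.
    rewrite ej in bj h3 *; have [b0|-> //] : b = 0%N \/ b = 1%N by lia.
    by move: h3; rewrite b0; lia.
  + split=> // -[j b] /= j0 bj /and3P[/= h1 h2 _].
    have ej : j = 1%N by lia.
    rewrite ej in bj h2 *; have [-> //|b1] : b = 0%N \/ b = 1%N by lia.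
    by move: h2; rewrite b1; lia.
  have [hV isoV] := sound V VVs; split=> //.
  have := pVs; rewrite path_sortedE; last exact: ltn_trans.
  by move=> /andP[/allP/(_ V.1)/(_ (map_f _ VVs)) /= V1 _]; apply: ltnW.
case=> j b /= j0 bj.
(* Vectors on the boundary of the initial cone are multiples of its edges. *)
have [->|b0] := eqVneq b 0%N.
  exists (1, 0)%N; first by rewrite !inE !eqxx ?orbT.
  by apply/and3P; split=> //=; nia.
have [->|bj'] := eqVneq b j.
  exists (1, 1)%N; first by rewrite !inE !eqxx ?orbT.
  by apply/and3P; split=> //=; nia.
have [|||||V VVs VW] := dom b (j%:Z - b%:Z) (j, b); rewrite /=; try lia.
by exists V.
Qed.

Section GroebnerData.
Variable Vs : seq (nat * nat).
Hypothesis Vs_isolated : forall V : nat * nat, V \in Vs ->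
  [/\ (0 < V.1)%N, (V.2 <= V.1)%N & isolated V].
Hypothesis Vs_complete : forall W, (0 < W.1)%N -> (W.2 <= W.1)%N ->
  exists2 V, V \in Vs & lead_dvd V W.

Definition lead_tail V := (lead V, tail V).
Definition lead_tails := (lead0, tail0) :: map lead_tail Vs.

Lemma lead_tails_fiber mm :
  mm \in lead_tails -> rees_exp mm.1 = rees_exp mm.2.
Proof.
rewrite inE => /predU1P[->|/mapP[V /Vs_isolated[_ hV _] ->]]; last first.
  exact: rees_exp_lead_tail.
by apply/rees_exp_eq; rewrite !monE; split; lia.
Qed.

Lemma lead_tails_prec mm : mm \in lead_tails -> prec mm.2 mm.1.
Proof.
rewrite inE => /predU1P[->|/mapP[V /Vs_isolated[V0 hV _] ->]]; last first.
  exact: prec_lead_tail.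
by rewrite precE !monE.
Qed.

Lemma lead_tails_div m m' : rees_exp m = rees_exp m' -> prec m' m ->
  exists2 mm, mm \in lead_tails & (mm.1 <= m)%MM.
Proof.
move=> e lt_m'm; have [le0m|[W [W0 hW leW]]] := fiber_div e lt_m'm.
  by exists (lead0, tail0); rewrite ?mem_head.
have [V VVs /lead_dvd_le VW] := Vs_complete W0 hW.
exists (lead_tail V); first by rewrite inE map_f ?orbT.
exact: lepm_trans leW.
Qed.

Lemma lead_tails_anti mm mm' : mm \in lead_tails -> mm' \in lead_tails ->
  (mm.1 <= mm'.1)%MM -> mm = mm'.
Proof.
rewrite !inE => /predU1P[->|/mapP[V /Vs_isolated[V0 hV _] ->]];
  move=> /predU1P[->|/mapP[W /Vs_isolated[W0 hW isoW] ->]] //=.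
- by move=> /mnm_le5; rewrite !monE => -[].
- by move=> /mnm_le5; rewrite !monE => -[_ _ _]; rewrite leqNgt V0.
by move=> /lead_dvd_le /(isoW V V0 hV) ->.
Qed.

Lemma lead_tails_unique_tail mm m : mm \in lead_tails ->
  rees_exp m = rees_exp mm.1 -> prec m mm.1 -> m = mm.2.
Proof.
rewrite inE => /predU1P[-> e lt_m|/mapP[V /Vs_isolated[_ hV isoV] ->]].
  exact: tail0_unique.
by case/(isolated_fiber hV isoV) => -> //=; rewrite prec_irr.
Qed.

Lemma uniq_lead_tails : uniq Vs -> uniq (map (@mbinom K 5) lead_tails).
Proof.
move=> uniq_Vs.
have lead_binom mm :
    mm \in lead_tails -> lead_monomial prec (@mbinom K 5 mm) mm.1.
  case: mm => l t ltLT.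
  exact: (lead_binomial K prec_irr (lead_tails_prec ltLT)).
rewrite map_inj_in_uniq => [|mm mm' mLT m'LT e].
  rewrite /= map_inj_in_uniq ?uniq_Vs ?andbT.
    apply/mapP => -[V _ /(congr1 fst) /mnm_eq5].
    by rewrite /= /lead /lead0 !monE => -[].
  move=> V W /Vs_isolated[V0 hV _] /Vs_isolated[_ _ isoW] /(congr1 fst) /= e.
  by apply: isoW => //; apply/lead_dvd_le; rewrite e lepm_refl.
apply: lead_tails_anti => //; have := lead_binom _ mLT; rewrite e => lead_m.
by rewrite (lead_monomial_uniq prec_asym lead_m (lead_binom _ m'LT)) lepm_refl.
Qed.

End GroebnerData.

(** * Minimal generators and the minimal Groebner basis *)

(** The function [rees_map] itself, packaged as a linear map. *)
Definition rees_lin : {linear {mpoly K[5]} -> {mpoly K[3]}} :=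
  comp_mpoly [tuple 'X_(Ordinal (isT : (0 < 3)%N));
  'X_(Ordinal (isT : (1 < 3)%N));
  'X_(Ordinal (isT : (0 < 3)%N)) ^+ d1 * 'X_(Ordinal (isT : (2 < 3)%N));
  'X_(Ordinal (isT : (0 < 3)%N)) ^+ u1 * 'X_(Ordinal (isT : (1 < 3)%N)) ^+ u2
     * 'X_(Ordinal (isT : (2 < 3)%N));
  'X_(Ordinal (isT : (1 < 3)%N)) ^+ d2 * 'X_(Ordinal (isT : (2 < 3)%N))].

Lemma rees_g0E : rees_g0 K d1 d2 = mbinom K (lead0, tail0).
Proof. by rewrite /mbinom /rees_g0 !mpolyX_mon !expr0 !expr1 !mul1r !mulr1. Qed.

Lemma rees_g0_gens :
  ideal_gen (fun g => g \in rees_gens K d1 d2 u1 u2) (rees_g0 K d1 d2).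
Proof.
pose g1 : {mpoly K[5]} := 'X_iT0 ^+ (d1 - u1) * 'X_iX1 - 'X_iT1 ^+ u2 * 'X_iX0.
pose g2 : {mpoly K[5]} := 'X_iT1 ^+ (d2 - u2) * 'X_iX1 - 'X_iT0 ^+ u1 * 'X_iX2.
have -> : rees_g0 K d1 d2 =
    'X_iT0 ^+ (d1 - u1) * g2 + (- 'X_iT1 ^+ (d2 - u2)) * g1.
  rewrite /rees_g0 /g1 /g2.
  rewrite -{1}(@subnKC u1 d1) -1?{1}(@subnKC u2 d2); try lia.
  by rewrite !exprD; ring.
by apply: ideal_genD; apply/ideal_genM/ideal_gen_mem; rewrite !inE eqxx ?orbT.
Qed.

Lemma rees_gens_binomial g : g \in rees_gens K d1 d2 u1 u2 ->
  exists a b, [/\ g = mbinom K (a, b), rees_exp a = rees_exp b & prec b a].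
Proof.
have [Vs [-> _ sound _]] := rees_gens_lattice.
move=> /mapP[V /sound[V0 hV _] ->]; exists (lead V), (tail V); split=> //.
  exact: rees_exp_lead_tail.
exact: prec_lead_tail.
Qed.

(** All binomials of the Groebner basis lower the weight X_0 + 2 X_1, since a
    vector (j, b) trades j factors X_1 for b <= j factors X_0 and g_0 trades X_0
    for X_2. *)
Lemma rees_gens_generate :
  generates (@rees_ideal K d1 d2 u1 u2) (rees_gens K d1 d2 u1 u2).
Proof.
move=> p; split=> [Rp|]; last first.
  apply: rees_ideal_gen => q /rees_gens_binomial[a [b [-> e _]]].
  exact: (toric_binomial (f := rees_lin) rees_mapX e).
have [Vs [eVs _ sound complete]] := rees_gens_lattice.
pose w (m : 'X_{1..5}) := (m iX0 + 2 * m iX1)%N.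
have wD : {morph w : m1 m2 / (m1 + m2)%MM >-> (m1 + m2)%N}.
  by move=> m1 m2; rewrite /w !mnmDE; lia.
have w_lt mm : mm \in lead_tails Vs -> (w mm.2 < w mm.1)%N.
  rewrite /w inE => /predU1P[->|/mapP[V /sound[V0 hV _] ->]] /=;
    by rewrite /lead0 /tail0 /lead /tail !monE ?muln0 ?addn0; lia.
have := toric_generated (f := rees_lin) rees_mapX prec_total
  (lead_tails_fiber sound) (lead_tails_div complete) rees_expD wD w_lt Rp.
apply: ideal_gen_trans => q.
rewrite /lead_tails /= -rees_g0E inE => /predU1P[->|].
  exact: rees_g0_gens.
by rewrite -map_comp -[map _ Vs]eVs; apply: ideal_gen_mem.
Qed.

Lemma rees_gens_indispensable (G : seq {mpoly K[5]}) :
  (forall g, g \in G -> pm1_binomial g /\ normalized prec g) ->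
  generates (rees_ideal d1 d2 u1 u2) G -> {subset rees_gens K d1 d2 u1 u2 <= G}.
Proof.
move=> Gbin Ggen g; have [Vs [-> _ sound _]] := rees_gens_lattice.
move=> /mapP[V /sound[V0 hV isoV] ->].
have GR h : h \in G -> rees_ideal d1 d2 u1 u2 h.
  by move=> hG; apply/Ggen/ideal_gen_mem.
apply: (indispensable prec_irr prec_asym rees_expD).
- move=> h hG; have [hbin hnorm] := Gbin h hG.
  exact: (toric_normalized (f := rees_lin) rees_mapX (GR h hG) hbin hnorm).
- exact: prec_lead_tail.
- by move=> m; apply: isolated_fiber.
- by move=> m; apply: lead_tail_coprime.
apply/Ggen/(toric_binomial (f := rees_lin) rees_mapX).
exact: rees_exp_lead_tail.
Qed.

Lemma min_binomial_gens_rees (G : seq {mpoly K[5]}) :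
  min_binomial_gens prec (rees_ideal d1 d2 u1 u2) G <->
  perm_eq G (rees_gens K d1 d2 u1 u2).
Proof.
have uniq_gens : uniq (rees_gens K d1 d2 u1 u2).
  have [Vs [-> uVs sound _]] := rees_gens_lattice.
  have := uniq_lead_tails sound uVs.
  by rewrite /lead_tails /= -map_comp => /andP[].
split=> [[uG Gbin Ggen Gmin]|eG].
  have sub := rees_gens_indispensable Gbin Ggen.
  apply: uniq_perm => // g; apply/idP/idP; last exact: sub.
  exact: (Gmin _ sub rees_gens_generate).
have memG := perm_mem eG.
have Gbin g : g \in G -> pm1_binomial g /\ normalized prec g.
  rewrite memG => /rees_gens_binomial[a [b [-> _ lt_ba]]]; split.
    by apply: pm1_binomial_mbinom; exact: (lt_neq prec_irr lt_ba).
  exact: (normalized_binomial K prec_irr lt_ba).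
split=> //; first by rewrite (perm_uniq eG).
- move=> p; rewrite (rees_gens_generate p).
  by split; apply: ideal_gen_sub => g; rewrite memG.
- move=> H HG Hgen g; rewrite memG; apply: rees_gens_indispensable => //.
  by move=> h /HG /Gbin.
Qed.

Lemma groebner_rees (G : seq {mpoly K[5]}) :
  perm_eq G (rees_gens K d1 d2 u1 u2) ->
  let Gbar := rees_g0 K d1 d2 :: G in
  minimal_groebner_basis prec (rees_ideal d1 d2 u1 u2) Gbar /\
  (forall B : seq {mpoly K[5]},
     all (@pm1_binomial K 5) B ->
     minimal_groebner_basis prec (rees_ideal d1 d2 u1 u2) B -> perm_eq B Gbar).
Proof.
have [Vs [eVs uVs sound complete]] := rees_gens_lattice.
move=> eG Gbar.
have eGbar : perm_eq Gbar (map (@mbinom K 5) (lead_tails Vs)).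
  by rewrite /Gbar rees_g0E /lead_tails /= perm_cons -map_comp -[map _ Vs]eVs.
have uGbar : uniq Gbar by rewrite (perm_uniq eGbar) (uniq_lead_tails sound).
split=> [|B Bbin Bgb].
  exact: (toric_minimal_groebner (f := rees_lin) rees_mapX prec_irr prec_asym
    (lead_tails_fiber sound) (lead_tails_prec sound) (lead_tails_div complete)
    (lead_tails_anti sound)
    uGbar (perm_mem eGbar)).
have [uB _ _ _] := Bgb.
rewrite (permPr eGbar); apply: uniq_perm => //.
  exact: uniq_lead_tails sound uVs.
exact: (toric_minimal_groebner_uniq (f := rees_lin) rees_mapX prec_irr prec_asym
    (lead_tails_fiber sound) (lead_tails_prec sound) (lead_tails_div complete)
    (lead_tails_anti sound)
    (lead_tails_unique_tail sound) Bbin Bgb).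
Qed.

End Rees.

Theorem theorem5p1 (K : fieldType) (d1 d2 u1 u2 : nat)
    (hu1 : (0 < u1 < d1)%N) (hu2 : (0 < u2 < d2)%N) :
  let R : {mpoly K[5]} -> Prop := rees_ideal d1 d2 u1 u2 in
  (forall G : seq {mpoly K[5]},
     min_binomial_gens prec R G <-> perm_eq G (rees_gens K d1 d2 u1 u2)) /\
  (forall G : seq {mpoly K[5]},
     min_binomial_gens prec R G ->
     let Gbar := rees_g0 K d1 d2 :: G in
     minimal_groebner_basis prec R Gbar /\
     (forall B : seq {mpoly K[5]},
        all (@pm1_binomial K 5) B -> minimal_groebner_basis prec R B ->
        perm_eq B Gbar)).
Proof.
split=> G; first exact: min_binomial_gens_rees.
by move=> /(min_binomial_gens_rees hu1 hu2) /(groebner_rees hu1 hu2).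
Qed.
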